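(* Let $F\subset\mathbb{R}^d$ be a compact convex set with $0\in\operatorname{int}(F)$, and let $m\ge2$, $1\le k\le m$. Then the function $f_k:\mathcal{X}\to\mathbb{R}$, $f_k(x,\Omega)=\sum_{i=1}^m\min_{1\le j\le k}T_F(x^j,\Omega^i)$, is $m\|F^\circ\|$-Lipschitz continuous on $\mathcal{X}=\mathbb{R}^{dk}\times\mathcal{K}^m$, i.e. $$|f_k(x,\Omega)-f_k(\hat x,\hat\Omega)|\le m\|F^\circ\|\,d_{\mathcal{X}}\big((x,\Omega),(\hat x,\hat\Omega)\big)\quad\text{for all }(x,\Omega),(\hat x,\hat\Omega)\in\mathcal{X}.$$
   Context: $\mathbb{R}^d$ ($d\ge1$) and $\mathbb{R}^{dk}=(\mathbb{R}^d)^k$ carry their Euclidean norms. $F^\circ=\{y\in\mathbb{R}^d\mid\langle y,x\rangle\le1\ \text{for all }x\in F\}$ and $\|F^\circ\|=\sup\{\|y\|\mid y\in F^\circ\}$. The minimal time function is $T_F(x,\Omega)=\inf\{t\ge 0\mid (x+tF)\cap\Omega\neq\emptyset\}$ for $x\in\mathbb{R}^d$ and nonempty $\Omega\subset\mathbb{R}^d$. $\mathcal{K}$ is the family of nonempty compact subsets of $\mathbb{R}^d$ with the Hausdorff metric $d_{\mathcal{K}}(A,B)=\max\{\sup_{a\in A}\inf_{b\in B}\|a-b\|,\ \sup_{b\in B}\inf_{a\in A}\|a-b\|\}$. On $\mathcal{K}^m$, with elements $\Omega=(\Omega^1,\dots,\Omega^m)$, $d_{\mathcal{K}^m}(\Omega,\hat\Omega)=\max_{1\le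 i\le m}d_{\mathcal{K}}(\Omega^i,\hat\Omega^i)$. On $\mathcal{X}=\mathbb{R}^{dk}\times\mathcal{K}^m$, $d_{\mathcal{X}}((x,\Omega),(\hat x,\hat\Omega))=\|x-\hat x\|+d_{\mathcal{K}^m}(\Omega,\hat\Omega)$. *)

(* Defs.v *)
From HB Require Import structures.
From mathcomp Require Import all_boot all_order all_algebra.
From mathcomp Require Import all_classical all_reals all_analysis.

Set Implicit Arguments.
Unset Strict Implicit.
Unset Printing Implicit Defensive.

Import Order.TTheory GRing.Theory Num.Theory.
Import numFieldNormedType.Exports.

Local Open Scope classical_set_scope.
Local Open Scope ring_scope.

(* R^d is 'rV[R]_d and R^(dk) = (R^d)^k is 'M[R]_(k, d), x^j being [row j x].
   The library norm `|x| on matrices is the max norm, hence [enorm] below;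
   both norms induce the same topology, so that the library's [compact] and
   [interior] are the Euclidean ones. *)

Definition enorm (R : realType) (k d : nat) (x : 'M[R]_(k, d)) : R :=
  Num.sqrt (\sum_(i < k) \sum_(j < d) x i j ^+ 2).

Definition inner (R : realType) (d : nat) (x y : 'rV[R]_d) : R :=
  \sum_(j < d) x 0 j * y 0 j.

Definition polar (R : realType) (d : nat) (F : set 'rV[R]_d) : set 'rV[R]_d :=
  [set y | forall x, F x -> inner y x <= 1].

(* [sup] and [inf] are real-valued and equal to 0 when the set is empty or
   not suitably bounded. This never happens below: [polar F] contains 0 and is
   bounded when 0 is interior to F, the set of times defining [min_time] is then
   nonempty for nonempty Omega, and [hausdorff_dist] is only used on nonempty
   compact sets. *)

Definition set_norm (R : realType) (d : nat) (A : set 'rV[R]_d) : R :=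
  sup [set enorm y | y in A].

Definition min_time (R : realType) (d : nat) (F : set 'rV[R]_d)
    (x : 'rV[R]_d) (Omega : set 'rV[R]_d) : R :=
  inf [set t : R | 0 <= t /\ [set x + t *: v | v in F] `&` Omega !=set0].

Definition hausdorff_dist (R : realType) (d : nat) (A B : set 'rV[R]_d) : R :=
  Num.max (sup [set inf [set enorm (a - b) | b in B] | a in A])
          (sup [set inf [set enorm (a - b) | a in A] | b in B]).

Record compacta (R : realType) (d : nat) : Type := Compacta {
  compacta_set :> set 'rV[R]_d;
  compacta_nonempty : compacta_set !=set0;
  compacta_compact : compact compacta_set
}.

(* Hausdorff distances are nonnegative, so the neutral element 0 does not
   affect the maximum. *)
Definition dist_Km (R : realType) (d m : nat)
    (Omega Omega' : 'I_m -> compacta R d) : R :=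
  \big[Num.max/0]_(i < m) hausdorff_dist (Omega i) (Omega' i).

Definition config (R : realType) (d k m : nat) : Type :=
  ('M[R]_(k, d) * ('I_m -> compacta R d))%type.

Definition dist_X (R : realType) (d k m : nat) (p q : config R d k m) : R :=
  enorm (p.1 - q.1) + dist_Km p.2 q.2.

(* Minimum of a finite family of reals; 0 for the empty family. *)
Definition fin_min (R : realType) (k : nat) : ('I_k -> R) -> R :=
  if k is k'.+1 then fun a : 'I_k'.+1 -> R => \big[Num.min/a ord0]_(j < k'.+1) a j
  else fun=> 0.

Definition f_obj (R : realType) (d k m : nat) (F : set 'rV[R]_d)
    (p : config R d k m) : R :=
  \sum_(i < m) fin_min (fun j : 'I_k => min_time F (row j p.1) (p.2 i)).

(* Main.v *)
(* Since F is closed, convex and contains a ball around 0, the bipolar theorem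
   shows that every displacement u lies in s F as soon as s > ||F°|| ||u||.
   If x' reaches b in Omega' in time t, and a in Omega is nearly nearest to b,
   the displacement (a - b) + (x' - x) can be made in time about
   ||F°|| (||x - x'|| + d(Omega, Omega')), and by convexity s F + t F is
   contained in (s + t) F, so that x reaches a in time s + t. *)

Require Import Defs.
From HB Require Import structures.
From mathcomp Require Import all_boot all_order all_algebra.
From mathcomp Require Import all_classical all_reals all_analysis.
From mathcomp Require Import ring lra.

Set Implicit Arguments.
Unset Strict Implicit.
Unset Printing Implicit Defensive.

Import Order.TTheory GRing.Theory Num.Theory.
Import numFieldNormedType.Exports.

Local Open Scope classical_set_scope.
Local Open Scope ring_scope.

(** * Inner product and Euclidean norm *)

Lemma innerC (R : realType) (d : nat) (x y : 'rV[R]_d) :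
  inner x y = inner y x.
Proof. by apply: eq_bigr => j _; rewrite mulrC. Qed.

Lemma innerDl (R : realType) (d : nat) (x y z : 'rV[R]_d) :
  inner (x + y) z = inner x z + inner y z.
Proof. by rewrite -big_split; apply: eq_bigr => j _ /=; rewrite mxE mulrDl. Qed.

Lemma innerZl (R : realType) (d : nat) (a : R) (x y : 'rV[R]_d) :
  inner (a *: x) y = a * inner x y.
Proof. by rewrite mulr_sumr; apply: eq_bigr => j _; rewrite mxE mulrA. Qed.

Lemma innerDr (R : realType) (d : nat) (x y z : 'rV[R]_d) :
  inner z (x + y) = inner z x + inner z y.
Proof. by rewrite innerC innerDl !(innerC z). Qed.

Lemma innerZr (R : realType) (d : nat) (a : R) (x y : 'rV[R]_d) :
  inner y (a *: x) = a * inner y x.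
Proof. by rewrite innerC innerZl (innerC y). Qed.

Lemma innerBl (R : realType) (d : nat) (x y z : 'rV[R]_d) :
  inner (x - y) z = inner x z - inner y z.
Proof. by rewrite innerDl -scaleN1r innerZl mulN1r. Qed.

Lemma innerBr (R : realType) (d : nat) (x y z : 'rV[R]_d) :
  inner z (x - y) = inner z x - inner z y.
Proof. by rewrite innerC innerBl !(innerC z). Qed.

Lemma inner_ge0 (R : realType) (d : nat) (x : 'rV[R]_d) : 0 <= inner x x.
Proof. by apply: sumr_ge0 => j _; rewrite -expr2 sqr_ge0. Qed.

Lemma enorm_ge0 (R : realType) (k d : nat) (x : 'M[R]_(k, d)) : 0 <= enorm x.
Proof. exact: sqrtr_ge0. Qed.

Lemma enorm_sqr (R : realType) (d : nat) (x : 'rV[R]_d) :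
  enorm x ^+ 2 = inner x x.
Proof.
rewrite sqr_sqrtr; last by apply: sumr_ge0 => i _; apply: sumr_ge0 => j _; exact: sqr_ge0.
by rewrite big_ord1; apply: eq_bigr => j _; rewrite expr2.
Qed.

Lemma enorm_row (R : realType) (k d : nat) (j : 'I_k) (x : 'M[R]_(k, d)) :
  enorm (row j x) <= enorm x.
Proof.
rewrite ler_sqrt; last by apply: sumr_ge0 => i _; apply: sumr_ge0 => *; exact: sqr_ge0.
rewrite big_ord1 (bigD1 j)//= (eq_bigr (fun l => x j l ^+ 2)); last first.
  by move=> l _; rewrite mxE.
by rewrite lerDl; apply: sumr_ge0 => i _; apply: sumr_ge0 => *; exact: sqr_ge0.
Qed.

Lemma coord_le_enorm (R : realType) (d : nat) (x : 'rV[R]_d) (j : 'I_d) :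
  `|x 0 j| <= enorm x.
Proof.
rewrite -(@ler_pXn2r _ 2)// ?nnegrE ?enorm_ge0// enorm_sqr real_normK ?num_real//.
rewrite /inner (bigD1 j)//= -expr2 lerDl.
by apply: sumr_ge0 => i _; rewrite -expr2 sqr_ge0.
Qed.

Lemma enorm0_eq0 (R : realType) (d : nat) (x : 'rV[R]_d) : enorm x = 0 -> x = 0.
Proof.
move=> x0; apply/rowP => j; rewrite mxE; apply/eqP.
by rewrite -normr_le0 -x0 coord_le_enorm.
Qed.

Lemma enorm0 (R : realType) (d : nat) : enorm (0 : 'rV[R]_d) = 0.
Proof.
by apply/eqP; rewrite -sqrf_eq0 enorm_sqr -(scale0r (0 : 'rV[R]_d)) innerZl mul0r.
Qed.

Lemma enormN (R : realType) (d : nat) (x : 'rV[R]_d) : enorm (- x) = enorm x.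
Proof.
apply/eqP; rewrite -(@eqrXn2 _ 2)// ?enorm_ge0// !enorm_sqr -scaleN1r.
by rewrite innerZl innerZr !mulN1r opprK.
Qed.

Lemma enormZ (R : realType) (d : nat) (a : R) (x : 'rV[R]_d) :
  0 <= a -> enorm (a *: x) = a * enorm x.
Proof.
move=> a0; apply/eqP; rewrite -(@eqrXn2 _ 2)// ?mulr_ge0 ?enorm_ge0//.
by rewrite exprMn !enorm_sqr innerZl innerZr mulrA expr2.
Qed.

(** Cauchy-Schwarz: with a, b the norms and c the inner product, the square of
    [enorm y *: x - enorm x *: y] expands to 2ab(ab - c). Dividing by ab forces the zero vectors to
    be treated first. *)
Lemma inner_le (R : realType) (d : nat) (x y : 'rV[R]_d) :
  inner x y <= enorm x * enorm y.
Proof.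
have [/enorm0_eq0 ->|x0] := eqVneq (enorm x) 0.
  by rewrite -{1}(scale0r 0) innerZl enorm0 !mul0r.
have [/enorm0_eq0 ->|y0] := eqVneq (enorm y) 0.
  by rewrite -{1}(scale0r 0) innerZr enorm0 mul0r mulr0.
have xy0 : 0 < enorm x * enorm y by rewrite mulr_gt0// lt_def enorm_ge0 ?x0 ?y0.
have := inner_ge0 (enorm y *: x - enorm x *: y).
rewrite !(innerBl, innerBr, innerZl, innerZr) (innerC y x) -!enorm_sqr.
set a := enorm x in xy0 *; set b := enorm y in xy0 *; set c := inner x y => h.
by rewrite -(ler_pM2l xy0); nra.
Qed.

Lemma enormD (R : realType) (d : nat) (x y : 'rV[R]_d) :
  enorm (x + y) <= enorm x + enorm y.
Proof.
rewrite -(@ler_pXn2r _ 2)// ?nnegrE ?addr_ge0 ?enorm_ge0//.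
rewrite enorm_sqr innerDl !innerDr (innerC y x) -!enorm_sqr.
by have := inner_le x y; nra.
Qed.

(** * Nearest points in compact convex sets *)

Lemma continuous_sqr_dist (R : realType) (d : nat) (u : 'rV[R]_d) :
  continuous (fun x : 'rV[R]_d => inner (u - x) (u - x)).
Proof.
apply: continuous_big => [|j _]; first exact: add_continuous.
have c : continuous (fun z : 'rV[R]_d => (u - z) 0 j).
  rewrite (_ : (fun z => _) = (fun z : 'rV[R]_d => u 0 j - z 0 j)); last first.
    by apply/funext => z; rewrite !mxE.
  by move=> x; apply: continuousB; [exact: cst_continuous|exact: coord_continuous].
by move=> x; apply: continuousM; exact: c.
Qed.

Lemma convex_setP (R : realType) (d : nat) (F : set 'rV[R]_d) (a : R)
    (v w : 'rV[R]_d) :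
  convex_set (F : set (convex_lmodType 'rV[R]_d)) -> 0 <= a <= 1 ->
  F v -> F w -> F (a *: v + (1 - a) *: w).
Proof.
move=> cF /andP[a0 a1] Fv Fw; apply/set_mem.
by have := cF v w (Itv01 a0 a1); apply; exact: mem_set.
Qed.

(** Take for p a point of F nearest to u. If the angle at p between u and some v in F were acute, a
    small move from p towards v would stay in F and come closer to u. *)
Lemma convex_compact_proj (R : realType) (d : nat) (F : set 'rV[R]_d)
    (u : 'rV[R]_d) :
  F !=set0 -> compact F -> convex_set (F : set (convex_lmodType 'rV[R]_d)) ->
  exists2 p, F p & forall v, F v -> inner (u - p) (v - p) <= 0.
Proof.
move=> F0 Fc cF.
have [p /set_mem Fp pmin] := compact_EVT_min F0 Fc
  (continuous_subspaceT (@continuous_sqr_dist _ _ u)).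
exists p => // v Fv; rewrite leNgt; apply/negP => c0.
set y := u - p in c0 *; set w := v - p in c0 *.
(* The unconstrained optimum <y, w> / <w, w> may exceed 1. Enlarging its denominator by <y, w> keeps
   a in (0, 1], and the squared distance still drops by a(1 + a)<y, w>. *)
pose a := inner y w / (inner y w + inner w w).
have w0 := inner_ge0 w.
have den0 : 0 < inner y w + inner w w by lra.
have a0 : 0 < a by rewrite divr_gt0.
have a1 : a <= 1 by rewrite ler_pdivrMr// mul1r lerDl.
have aE : a * (inner y w + inner w w) = inner y w by rewrite divfK// gt_eqF.
have Fz : F (a *: v + (1 - a) *: p) by apply: convex_setP; rewrite ?(ltW a0).
have := pmin _ (mem_set Fz).
have -> : u - (a *: v + (1 - a) *: p) = y - a *: w.
  by rewrite /y /w; apply/rowP => j; rewrite !mxE; ring.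
rewrite -/y; clearbody a w y.
rewrite !(innerBl, innerBr, innerZl, innerZr) (innerC w y); nra.
Qed.

(** * Polar of a set with 0 in its interior *)

Lemma interior0_enorm (R : realType) (d : nat) (F : set 'rV[R]_d) :
  interior F (0 : 'rV[R]_d) ->
  exists2 e : R, 0 < e & forall x, enorm x < e -> F x.
Proof.
move=> /nbhs_ballP[e /= e0 eF]; exists e => // x xe; apply: eF.
split=> // i j; rewrite ord1 /ball/= mxE sub0r normrN.
exact: le_lt_trans (coord_le_enorm x j) xe.
Qed.

Lemma interior0_ray (R : realType) (d : nat) (F : set 'rV[R]_d) :
  interior F (0 : 'rV[R]_d) ->
  exists2 e : R, 0 < e & forall x, x != 0 -> F ((e / enorm x) *: x).
Proof.
move=> /interior0_enorm[e e0 eF]; exists (e / 2); first by rewrite divr_gt0.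
move=> x x0; have nx0 : enorm x != 0 by apply: contra_neq x0; exact: enorm0_eq0.
apply: eF; rewrite enormZ ?divfK//; first lra.
by rewrite divr_ge0 ?enorm_ge0// divr_ge0// ltW.
Qed.

(** Testing y against the point of F at distance e from 0 in the direction of y gives e |y| <= 1.
    This bound makes the [sup] in [set_norm] a true supremum. *)
Lemma polar_enorm_le (R : realType) (d : nat) (F : set 'rV[R]_d) :
  interior F (0 : 'rV[R]_d) ->
  exists M, forall y, polar F y -> enorm y <= M.
Proof.
move=> /interior0_ray[e e0 eF]; exists e^-1 => y Fy.
have [->|y0] := eqVneq y 0; first by rewrite enorm0 invr_ge0 ltW.
have ny0 : enorm y != 0 by apply: contra_neq y0; exact: enorm0_eq0.
have := Fy _ (eF _ y0); rewrite innerZr -enorm_sqr expr2 mulrA divfK// mulrC.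
by rewrite -ler_pdivlMr// mul1r.
Qed.

Lemma polar_le_set_norm (R : realType) (d : nat) (F : set 'rV[R]_d) y :
  interior F (0 : 'rV[R]_d) -> polar F y -> enorm y <= set_norm (polar F).
Proof.
move=> F0 Fy; apply: ub_le_sup; last by exists y.
by have [M MF] := polar_enorm_le F0; exists M => _ [z Fz <-]; exact: MF.
Qed.

Lemma set_norm_polar_ge0 (R : realType) (d : nat) (F : set 'rV[R]_d) :
  interior F (0 : 'rV[R]_d) -> 0 <= set_norm (polar F).
Proof.
move=> F0; rewrite -(@enorm0 R d); apply: polar_le_set_norm => // x _.
by rewrite -(scale0r 0) innerZl mul0r ler01.
Qed.

(* If u is not in F, then y = u - p, with p the projection of u on F, satisfies
   <y, v> <= s for v in F and <y, u> > s, where s = <y, p>; s > 0 since 0 is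
   interior, so that y / s is in the polar. *)
Lemma mem_of_set_norm_polar (R : realType) (d : nat) (F : set 'rV[R]_d)
    (u : 'rV[R]_d) :
  compact F -> convex_set (F : set (convex_lmodType 'rV[R]_d)) ->
  interior F (0 : 'rV[R]_d) -> set_norm (polar F) * enorm u < 1 -> F u.
Proof.
move=> Fc cF F0 u1.
have [p Fp pP] : exists2 p, F p & forall v, F v -> inner (u - p) (v - p) <= 0.
  by apply: convex_compact_proj => //; exists 0; exact: interior_subset.
have [/subr0_eq ->//|y0] := eqVneq (u - p) 0.
set y := u - p in pP y0 *; pose s := inner y p.
have ny0 : 0 < enorm y.
  by rewrite lt_def enorm_ge0 andbT; apply: contra_neq y0; exact: enorm0_eq0.
have s0 : 0 < s.
  have [e e0 /(_ _ y0)/pP] := interior0_ray F0.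
  rewrite innerBr -/s subr_le0; apply: lt_le_trans.
  by rewrite innerZr -enorm_sqr expr2 mulrA divfK ?gt_eqF// mulr_gt0.
have yF : polar F (s^-1 *: y).
  move=> v /pP; rewrite innerBr -/s subr_le0 innerZl mulrC => ys.
  by rewrite ler_pdivrMr// mul1r.
have := inner_le (s^-1 *: y) u.
have -> : u = p + y by rewrite /y addrC subrK.
rewrite innerZl innerDr -/s -enorm_sqr.
move=> h.
have : s^-1 * (s + enorm y ^+ 2) <= set_norm (polar F) * enorm u.
  apply: (le_trans h); rewrite /y (addrC p) subrK.
  by apply: ler_wpM2r; [exact: enorm_ge0|exact: polar_le_set_norm].
move=> /le_lt_trans/(_ u1); rewrite mulrC ltr_pdivrMr// mul1r.
by rewrite ltNge lerDl sqr_ge0.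
Qed.

(** * Multiples of F *)

Lemma scaled_mem (R : realType) (d : nat) (F : set 'rV[R]_d)
    (u : 'rV[R]_d) (s : R) :
  compact F -> convex_set (F : set (convex_lmodType 'rV[R]_d)) ->
  interior F (0 : 'rV[R]_d) -> set_norm (polar F) * enorm u < s ->
  exists2 g, F g & u = s *: g.
Proof.
move=> Fc cF F0 us.
have s0 : 0 < s.
  by apply: le_lt_trans us; rewrite mulr_ge0 ?enorm_ge0 ?set_norm_polar_ge0.
exists (s^-1 *: u); last by rewrite scalerA divff ?scale1r ?gt_eqF.
apply: mem_of_set_norm_polar => //.
by rewrite enormZ ?invr_ge0 ?ltW// mulrCA mulrC ltr_pdivrMr// mul1r.
Qed.

(** Dividing by s + t leaves a convex combination of g and h with weights s / (s + t) and t / (s +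
    t); s > 0 keeps the divisor nonzero when t = 0. *)
Lemma scaled_memD (R : realType) (d : nat) (F : set 'rV[R]_d) (s t : R)
    (g h : 'rV[R]_d) :
  convex_set (F : set (convex_lmodType 'rV[R]_d)) -> 0 < s -> 0 <= t ->
  F g -> F h -> exists2 v, F v & s *: g + t *: h = (s + t) *: v.
Proof.
move=> cF s0 t0 Fg Fh; have st0 : 0 < s + t by lra.
pose a := s / (s + t).
have ea : (s + t) * a = s by rewrite mulrC divfK ?gt_eqF.
have a01 : 0 <= a <= 1.
  by rewrite /a divr_ge0 ?(ltW s0) ?(ltW st0)//= ler_pdivrMr// mul1r lerDl.
exists (a *: g + (1 - a) *: h); first exact: convex_setP.
rewrite scalerDr !scalerA ea; congr (_ + _ *: _).
by rewrite mulrBr mulr1 ea addrAC subrr add0r.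
Qed.

(** * Hausdorff distance *)

Lemma hausdorff_distC (R : realType) (d : nat) (A B : set 'rV[R]_d) :
  hausdorff_dist A B = hausdorff_dist B A.
Proof.
have flip (C D : set 'rV[R]_d) :
    [set inf [set enorm (a - b) | b in D] | a in C] =
    [set inf [set enorm (b - a) | b in D] | a in C].
  apply: eq_imagel => a _; congr inf; apply: eq_imagel => b _.
  by rewrite -enormN opprB.
by rewrite /hausdorff_dist -(flip A B) -(flip B A) maxC.
Qed.

(** The slack e is there because the infimum over A need not be attained: A is only assumed
    nonempty. *)
Lemma hausdorff_dist_approx (R : realType) (d : nat) (A B : set 'rV[R]_d)
    (b : 'rV[R]_d) (e : R) :
  A !=set0 -> compact B -> B b -> 0 < e -> exists2 a, A a & enorm (a - b) < hausdorff_dist A B + e.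
Proof.
move=> [a0 Aa0] Bc Bb e0.
pose D z := [set enorm (a - z) | a in A].
have D0 z : D z !=set0 by exists (enorm (a0 - z)); exists a0.
have Dlb z : has_lbound (D z) by exists 0 => _ [a _ <-]; exact: enorm_ge0.
(* Without an upper bound [sup] would be the default 0. Each infimum is at most the distance to the
   fixed point a0, which is bounded on the compact set B. *)
have ub : has_ubound [set inf (D z) | z in B].
  have [c _ cmax] := compact_EVT_max (ex_intro _ b Bb) Bc
    (continuous_subspaceT (@continuous_sqr_dist _ _ a0)).
  exists (enorm (a0 - c)) => _ [z Bz <-].
  apply: (@le_trans _ _ (enorm (a0 - z))); first by apply: ge_inf => //; exists a0.
  rewrite -(@ler_pXn2r _ 2)// ?nnegrE ?enorm_ge0// !enorm_sqr.
  by apply: cmax; exact: mem_set.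
have bh : inf (D b) < hausdorff_dist A B + e.
  apply: (@le_lt_trans _ _ (hausdorff_dist A B)); last by rewrite ltrDl.
  by rewrite /hausdorff_dist le_max; apply/orP; right; apply: ub_le_sup => //; exists b.
by have [_ [a Aa <-] lt] := inf_lt (D0 b) bh; exists a.
Qed.

(** * One-sided Lipschitz bound for the minimal time *)

Lemma min_time_le (R : realType) (d : nat) (F : set 'rV[R]_d)
    (x x' : 'rV[R]_d) (A B : set 'rV[R]_d) :
  A !=set0 -> B !=set0 -> compact B -> compact F -> convex_set (F : set (convex_lmodType 'rV[R]_d)) ->
  interior F (0 : 'rV[R]_d) ->
  min_time F x A <= min_time F x' B +
    set_norm (polar F) * (enorm (x - x') + hausdorff_dist A B).
Proof.
move=> A0 [b0 Bb0] Bc Fc cF F0; set N := set_norm _; set D := _ + hausdorff_dist A B.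
have N0 : 0 <= N by exact: set_norm_polar_ge0.
rewrite -lerBlDr; apply: lb_le_inf.
  (* The times for x' and B must form a nonempty set, as [inf] of the empty set is 0. The point b0
     is reached in the time below, where + 1 provides the strict inequality of [scaled_mem]. *)
  have [|g Fg gE] :=
    @scaled_mem _ _ F (b0 - x') (N * enorm (b0 - x') + 1) Fc cF F0.
    by rewrite ltrDl.
  exists (N * enorm (b0 - x') + 1); split.
    by rewrite addr_ge0// mulr_ge0// enorm_ge0.
  exists b0; split=> //; exists g => //.
  by rewrite -gE addrC subrK.
move=> t [t0 [_ [[v Fv <-] Bb]]].
rewrite lerBlDr; apply/ler_addgt0Pr => e e0.
(* Chosen so that N e' < e; the + 1 covers N = 0 and makes this strict. *)
pose e' := e / (N + 1).
have N1 : 0 < N + 1 by lra.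
have e'0 : 0 < e' by rewrite divr_gt0.
have ee' : (N + 1) * e' = e by rewrite mulrC divfK ?gt_eqF.
have [a Aa ab] := hausdorff_dist_approx A0 Bc Bb e'0.
(* This is the correction for which x + u + t v = a. Its two summands are controlled by the
   Hausdorff distance and by |x - x'|. *)
pose u := (a - (x' + t *: v)) + (x' - x).
have uD : enorm u <= D + e'.
  apply: (le_trans (enormD _ _)); rewrite -(opprB x) enormN /D; lra.
have uN : N * enorm u < N * D + e.
  by apply: (@le_lt_trans _ _ (N * (D + e'))); [exact: ler_wpM2l|nra].
have s0 : 0 < N * D + e.
  by apply: le_lt_trans uN; rewrite mulr_ge0// enorm_ge0.
have [g Fg gE] := scaled_mem Fc cF F0 uN.
have [h Fh hE] := scaled_memD cF s0 t0 Fg Fv.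
(* The right-hand side becomes s + t with s = N D + e, which is shown to be an admissible time from
   x to A. *)
rewrite -addrA [t + _]addrC.
apply: ge_inf; first by exists 0 => z [].
split; first by rewrite addr_ge0// ltW.
exists a; split => //; exists h => //.
rewrite -hE -gE /u; apply/rowP => j; rewrite !mxE; ring.
Qed.

Lemma fin_min_le (R : realType) (k : nat) (a b : 'I_k -> R) (c : R) :
  (1 <= k)%N -> (forall j, a j <= b j + c) -> fin_min a <= fin_min b + c.
Proof.
(* For k = 0 both minima are the default 0 and the claim would read 0 <= c, with no sign known for
   c. *)
case: k a b => // k a b _ ab; rewrite -lerBlDr.
have aj j : fin_min a - c <= b j.
  by rewrite lerBlDr; apply: le_trans (ab j); exact: bigmin_le.
by apply: le_bigmin.
Qed.

Lemma hausdorff_le_dist_Km (R : realType) (d m : nat)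
    (Omega Omega' : 'I_m -> compacta R d) (i : 'I_m) :
  hausdorff_dist (Omega i) (Omega' i) <= dist_Km Omega Omega'.
Proof. exact: le_bigmax. Qed.

Lemma dist_XC (R : realType) (d k m : nat) (p q : config R d k m) :
  dist_X p q = dist_X q p.
Proof.
congr (_ + _); last by apply: eq_bigr => i _; exact: hausdorff_distC.
congr Num.sqrt; apply: eq_bigr => i _; apply: eq_bigr => j _.
by rewrite !mxE -sqrrN opprB.
Qed.

Lemma f_obj_le (R : realType) (d m k : nat) (F : set 'rV[R]_d)
    (p q : config R d k m) :
  (1 <= k)%N -> compact F ->
  convex_set (F : set (convex_lmodType 'rV[R]_d)) ->
  interior F (0 : 'rV[R]_d) ->
  f_obj F p <= f_obj F q + m%:R * set_norm (polar F) * dist_X p q.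
Proof.
(* The factor m is spread as a constant sum over ['I_m], so that the bound can be proved for each
   target set separately. *)
move=> k1 Fc cF F0; rewrite -mulrA mulr_natl -[X in _ *+ X]card_ord -sumr_const.
rewrite -big_split; apply: ler_sum => i _ /=; apply: fin_min_le => // j.
have := min_time_le (row j p.1) (row j q.1) (compacta_nonempty (p.2 i))
  (compacta_nonempty (q.2 i)) (@compacta_compact _ _ (q.2 i)) Fc cF F0.
move/le_trans; apply.
rewrite lerD2l; apply: ler_wpM2l; first exact: set_norm_polar_ge0.
apply: lerD; last exact: hausdorff_le_dist_Km.
by rewrite -linearB; exact: enorm_row.
Qed.

Theorem theorem5p4 (R : realType) (d m k : nat) (F : set 'rV[R]_d)
    (hd : (1 <= d)%N) (hm : (2 <= m)%N) (hk1 : (1 <= k)%N) (hkm : (k <= m)%N)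
    (F_compact : compact F)
    (F_convex : convex_set (F : set (convex_lmodType 'rV[R]_d)))
    (F_int : interior F (0 : 'rV[R]_d)) :
  forall p q : config R d k m,
    `|f_obj F p - f_obj F q| <= m%:R * set_norm (polar F) * dist_X p q.
Proof.
(* The two signs of the difference are [f_obj_le] for (p, q) and, by symmetry of [dist_X], for (q,
   p). *)
move=> p q; rewrite ler_norml lerBrDl lerBlDl lerBlDr.
by rewrite !(addrC (_ * _)) (f_obj_le p q)// andbT dist_XC f_obj_le.
Qed.
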